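(* Let $n\in\mathbb{Z}$ and $m\in\mathbb{N}$, $m\ge 1$. For $\mathbf{k}=(k_1,k_2,\dots,k_m)\in\mathbb{Z}^m$ write $|\mathbf{k}|:=k_1+k_2+\dots+k_m$. Then for all $\mathbf{x}_1,\mathbf{x}_2,\dots,\mathbf{x}_m\in\mathbb{R}^2$, $$\sum_{\mathbf{k}\in\mathbb{Z}^m,\ |\mathbf{k}|=n}\ \prod_{i=1}^{m} \mathrm{e}^{\mathrm{i}k_i\arg(\mathbf{x}_i)}\,J_{k_i}(|\mathbf{x}_i|) \;=\; J_n\!\left(\left|\sum_{i=1}^m \mathbf{x}_i\right|\right)\mathrm{e}^{\mathrm{i}n\arg\left(\sum_{i=1}^m\mathbf{x}_i\right)}.$$
   Context: $J_k$ denotes the $k$-th order Bessel function of the first kind, $k\in\mathbb{Z}$ (so $J_{-k}=(-1)^kJ_k$). In exponents, $\mathrm{i}$ (upright) is the imaginary unit, while the product index $i$ is an integer. For $\mathbf{x}\in\mathbb{R}^2$, $|\mathbf{x}|$ is the Euclidean norm (modulus), and $\arg(\mathbf{x})$ is the anticlockwise angle from the positive $x$-axis to the vector $\mathbf{x}$; $\arg(\mathbf{0})$ is assigned an arbitrary real value. Note that $|\mathbf{k}|$ for $\mathbf{k}\in\mathbb{Z}^m$ is the (signed) sum of the entries, not a norm. *)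

(* Defs.v *)
From HB Require Import structures.
From mathcomp Require Import all_boot all_order all_algebra.
From mathcomp Require Import complex.
From mathcomp Require Import all_classical all_reals all_analysis.
From mathcomp.analysis.showcase Require Export summability.
Set Implicit Arguments.
Unset Strict Implicit.
Unset Printing Implicit Defensive.
Import Order.TTheory GRing.Theory Num.Theory.
Import numFieldNormedType.Exports.
Local Open Scope classical_set_scope.
Local Open Scope ring_scope.
Local Open Scope complex_scope.

(* The library declares this instance inside a section, hence not globally. *)
#[export] Existing Instance totally_filter.

(* The term of index j of the power series of the Bessel function of the first
   kind of order p >= 0, evaluated at x:
     J_p(x) = \sum_(j >= 0) (-1)^j / (j! (j + p)!) (x / 2)^(2 j + p). *)
Definition bessel_term (R : realType) (p : nat) (x : R) (j : nat) : R :=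
  (-1) ^+ j / (j`! * (j + p)`!)%:R * (x / 2) ^+ (2 * j + p).

(* Negative orders: J_(-p) = (-1)^p J_p; recall that Negz p is - p.+1. *)
Definition besselJ (R : realType) (k : int) (x : R) : R :=
  match k with
  | Posz p => limn (series (bessel_term p x))
  | Negz p => (-1) ^+ p.+1 * limn (series (bessel_term p.+1 x))
  end.

(* The library norm `|v| on row vectors is the sup norm. *)
Definition norm2 (R : realType) (v : 'rV[R]_2) : R :=
  Num.sqrt (v 0 0 ^+ 2 + v 0 1 ^+ 2).

(* arg is any determination of the polar angle; arg 0 is unconstrained. *)
Definition is_arg (R : realType) (arg : 'rV[R]_2 -> R) : Prop :=
  forall v : 'rV[R]_2, v != 0 ->
    v 0 0 = norm2 v * cos (arg v) /\ v 0 1 = norm2 v * sin (arg v).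

Definition expi (R : realType) (t : R) : R[i] := cos t +i* sin t.

(* Main.v *)
Require Import Defs.
From HB Require Import structures.
From mathcomp Require Import all_boot all_order all_algebra.
From mathcomp Require Import complex.
From mathcomp Require Import all_classical all_reals all_analysis.
From mathcomp Require Import finmap zify ring.
Set Implicit Arguments.
Unset Strict Implicit.
Unset Printing Implicit Defensive.
Import Order.TTheory GRing.Theory Num.Theory.
Import numFieldNormedType.Exports.
Local Open Scope classical_set_scope.
Local Open Scope ring_scope.
Local Open Scope complex_scope.

(**
  Identify x with the complex number 2 z. Then J_k(|x|) e^(i k arg x) is the
  coefficient of t^k in exp(z t) exp(- z^* / t), i.e. the sum over naturals
  a - b = k of z^a / a! * (- z^* )^b / b!. The product over i of these expansions
  is an absolutely convergent family indexed by (a, b) in N^m x N^m. Grouping it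
  by the values k_i = a_i - b_i gives the left-hand side; grouping it by the
  totals A = \sum a_i, B = \sum b_i gives, by the multinomial theorem, the same
  expansion for \sum x_i. To compare the groupings with finite sums only, all
  a_i, b_i are truncated at N: once a finite set of k's contains every index that
  meets the levels J < M, the discrepancy is at most the tail over J >= M of the
  majorant series obtained by replacing each term with its norm.
*)

(** * Divided powers and truncated exponential series *)

Definition powfact (F : numFieldType) (c : F) (a : nat) : F := c ^+ a / a`!%:R.

Definition int_pos (k : int) : nat := if k is Posz p then p else 0%N.

Definition int_neg (k : int) : nat := if k is Negz p then p.+1 else 0%N.

(* The term of level j in the coefficient of t^k of exp(x t) exp(y / t): the
   exponents are a = j + max(k, 0) and b = j + max(- k, 0), so that a - b = k. *)
Definition laurent_term (F : numFieldType) (k : int) (x y : F) (j : nat) : F :=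
  powfact x (j + int_pos k) * powfact y (j + int_neg k).

Section PowFact.
Variable F : numFieldType.
Implicit Types (c x y : F) (a b j N : nat) (k : int).

Lemma powfact_ge0 c a : 0 <= c -> 0 <= powfact c a.
Proof. by move=> c0; rewrite /powfact divr_ge0 ?exprn_ge0. Qed.

Lemma norm_powfact c a : `|powfact c a| = powfact `|c| a.
Proof. by rewrite /powfact normrM normfV normrX normr_nat. Qed.

Lemma norm_laurent_term k x y j :
  `|laurent_term k x y j| = laurent_term k `|x| `|y| j.
Proof. by rewrite /laurent_term normrM !norm_powfact. Qed.

Lemma laurent_term_ge0 k x y j :
  0 <= x -> 0 <= y -> 0 <= laurent_term k x y j.
Proof. by move=> x0 y0; rewrite mulr_ge0 ?powfact_ge0. Qed.

Lemma powfactD x y a :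
  powfact (x + y) a = \sum_(i < a.+1) powfact x i * powfact y (a - i).
Proof.
rewrite /powfact addrC exprDn mulr_suml; apply: eq_bigr => i _.
have ia : (i <= a)%N by rewrite -ltnS.
have := bin_fact ia => /(congr1 (fun n => n%:R : F)); rewrite !natrM => <-.
have nz n : n`!%:R != 0 :> F by rewrite pnatr_eq0 -lt0n fact_gt0.
have bz : 'C(a, i)%:R != 0 :> F by rewrite pnatr_eq0 -lt0n bin_gt0.
by rewrite -mulr_natr; field; rewrite bz !nz.
Qed.

Definition trunc_exp N c : {poly F} := \poly_(a < N) powfact c a.

(* The multinomial theorem, read off a product of exponential series; the
   truncation does not affect the coefficients of degree less than N. *)
Lemma coef_prod_trunc_exp (I : Type) (r : seq I) (c : I -> F) N a :
  (a < N)%N ->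
  (\prod_(i <- r) trunc_exp N (c i))`_a = powfact (\sum_(i <- r) c i) a.
Proof.
elim: r a => [|i r IH] a aN.
  by rewrite !big_nil coef1 /powfact; case: a aN => [|a] _;
    rewrite ?expr0 ?fact0 ?divr1 // expr0n mul0r.
rewrite !big_cons powfactD coefM; apply: eq_bigr => -[j /= ja] _.
by rewrite coef_poly IH; [case: ltnP => //; lia|lia].
Qed.

Lemma coef_prod_trunc_exp_ge0 (I : Type) (r : seq I) (c : I -> F) N a :
  (forall i, 0 <= c i) -> 0 <= (\prod_(i <- r) trunc_exp N (c i))`_a.
Proof.
move=> c0; elim: r a => [|i r IH] a; first by rewrite big_nil coef1.
rewrite big_cons coefM sumr_ge0 // => j _; rewrite mulr_ge0 // coef_poly.
by case: ifP => // _; rewrite powfact_ge0.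
Qed.

(** Truncation only removes nonnegative terms from the multinomial expansion, so in degrees at least
    [N], where equality may fail, an upper bound survives. *)
Lemma coef_prod_trunc_exp_le (I : Type) (r : seq I) (c : I -> F) N a :
  (forall i, 0 <= c i) ->
  (\prod_(i <- r) trunc_exp N (c i))`_a <= powfact (\sum_(i <- r) c i) a.
Proof.
move=> c0; elim: r a => [|i r IH] a.
  by rewrite !big_nil coef1 /powfact; case: a => [|a];
    rewrite ?expr0 ?fact0 ?divr1 // expr0n mul0r.
rewrite !big_cons powfactD coefM; apply: ler_sum => -[j /= ja] _.
rewrite ler_pM ?coef_prod_trunc_exp_ge0 // coef_poly; case: ifP => // _;
by rewrite powfact_ge0.
Qed.

(** Expanding the product of polynomials picks one exponent [e i] per factor, and the resulting
    monomial has degree [\sum_i e i]. *)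
Lemma sum_prod_powfact m N (c : 'I_m -> F) (a : nat) :
  \sum_(e : {ffun 'I_m -> 'I_N} | (\sum_i e i)%N == a)
     \prod_i powfact (c i) (e i) = (\prod_i trunc_exp N (c i))`_a.
Proof.
rewrite /trunc_exp; under [in RHS]eq_bigr do rewrite poly_def.
rewrite bigA_distr_bigA coef_sum big_mkcond; apply: eq_bigr => e _.
rewrite [in RHS]scaler_prod prodrXr coefZ coefXn eq_sym.
by case: eqP => _; rewrite ?mulr1 ?mulr0.
Qed.

End PowFact.

(** * Truncated Laurent coefficients, grouped by differences and by levels *)

Definition trunc_laurent (F : numFieldType) (N : nat) (k : int) (x y : F) : F :=
  \sum_(a < N) \sum_(b < N | a%:Z - b%:Z == k) powfact x a * powfact y b.

(** When a - b = k the smaller exponent is the level j and the larger is j + |k|; only the latter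
    has to be kept below [N]. *)
Lemma trunc_laurentE (F : numFieldType) (N : nat) (k : int) (x y : F) :
  trunc_laurent N k x y = \sum_(j < N - `|k|) laurent_term k x y j.
Proof.
rewrite /trunc_laurent (big_ord_widen N (laurent_term k x y)) ?leq_subr //.
rewrite [RHS]big_mkcond /laurent_term; case: k => p /=.
  under eq_bigr do rewrite big_mkcond.
  rewrite exchange_big; apply: eq_bigr => b _; rewrite -big_mkcond /=.
  rewrite (eq_bigl (fun a : 'I_N => a == b + p :> nat)%N); last first.
    by move=> a; apply/eqP/eqP; lia.
  rewrite (big_ord1_eq _ (fun a => powfact x a * powfact y b)) addn0.
  by rewrite ltn_subRL addnC.
apply: eq_bigr => a _.
rewrite (eq_bigl (fun b : 'I_N => b == a + p.+1 :> nat)%N); last first.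
  by move=> b; apply/eqP/eqP; lia.
rewrite (big_ord1_eq _ (fun b => powfact x a * powfact y b)) addn0.
by rewrite ltn_subRL addnC.
Qed.

Lemma int_pos_negP (n : int) :
  n = (int_pos n)%:Z - (int_neg n)%:Z /\ `|n|%N = (int_pos n + int_neg n)%N.
Proof. by case: n => p /=; lia. Qed.

Section Truncation.
Variables (F : numFieldType) (m : nat) (x y : 'I_m -> F).

Let idx N := ({ffun 'I_m -> 'I_N} * {ffun 'I_m -> 'I_N})%type.

Let diff N (e : idx N) : {ffun 'I_m -> int} :=
  [ffun i => (e.1 i)%:Z - (e.2 i)%:Z].

Let mon (u v : 'I_m -> F) N (e : idx N) : F :=
  (\prod_i powfact (u i) (e.1 i)) * \prod_i powfact (v i) (e.2 i).

Let tot N (e : {ffun 'I_m -> 'I_N}) : nat := \sum_i e i.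

Lemma prod_trunc_laurent N (k : {ffun 'I_m -> int}) :
  \prod_i trunc_laurent N (k i) (x i) (y i)
  = \sum_(e : idx N | diff e == k) mon x y e.
Proof.
rewrite /trunc_laurent.
under eq_bigr => i _ do under eq_bigr do rewrite big_mkcond.
rewrite bigA_distr_bigA; under eq_bigr do rewrite bigA_distr_bigA.
rewrite pair_bigA [RHS]big_mkcond; apply: eq_bigr => e _ /=.
case: eqP => [<-|dk].
  rewrite /mon -big_split; apply: eq_bigr => i _ /=.
  by rewrite ffunE eqxx.
have [i ki|nk] := pickP (fun i => (e.1 i)%:Z - (e.2 i)%:Z != k i).
  by rewrite (bigD1 i) //= (negbTE ki) mul0r.
case: dk; apply/ffunP => i; rewrite ffunE; apply/eqP.
by have := nk i => /negbFE.
Qed.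

Lemma sum_diff N (e : idx N) :
  \sum_i diff e i = (tot e.1)%:Z - (tot e.2)%:Z.
Proof.
rewrite /tot !(big_morph Posz PoszD (erefl _)) -sumrB.
by apply: eq_bigr => i _; rewrite ffunE.
Qed.

(** Once the differences sum to [n], the level J determines both totals. All totals are at most
    [N * m], so every level occurs below [Q]. *)
Lemma sum_level N Q n (P : pred nat) (G : idx N -> F) :
  (N * m < Q)%N ->
  \sum_(e : idx N | (\sum_i diff e i == n) && P (tot e.1 - int_pos n)%N) G e
  = \sum_(J < Q | P J)
      \sum_(e : idx N | (tot e.1 == J + int_pos n)%N
                        && (tot e.2 == J + int_neg n)%N) G e.
Proof.
move=> NQ; have nE := int_pos_negP n.
have totQ (e : idx N) : (tot e.1 - int_pos n < Q)%N.
  apply: leq_ltn_trans NQ; rewrite (leq_trans (leq_subr _ _)) // /tot.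
  rewrite (leq_trans (@leq_sum _ _ _ _ (fun=> N) _)) //.
    by move=> i _; exact: ltnW.
  by rewrite sum_nat_const card_ord mulnC.
rewrite (partition_big (fun e => Ordinal (totQ e)) (fun J : 'I_Q => P J)) /=;
  last by move=> e /andP[].
apply: eq_bigr => J PJ; apply: eq_bigl => e; rewrite sum_diff -val_eqE /=.
apply/andP/andP => [[/andP[/eqP en _] /eqP eJ]|[/eqP e1 /eqP e2]].
  by split; apply/eqP; lia.
have eJ : (tot e.1 - int_pos n)%N = J by rewrite e1 addnK.
by rewrite eJ PJ andbT; split => //; apply/eqP; lia.
Qed.

Lemma sum_mon N (u v : 'I_m -> F) a b :
  \sum_(e : idx N | (tot e.1 == a)%N && (tot e.2 == b)%N) mon u v e
  = (\prod_i trunc_exp N (u i))`_a * (\prod_i trunc_exp N (v i))`_b.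
Proof.
rewrite -!sum_prod_powfact big_distrlr /=.
by rewrite (pair_big (fun e : {ffun 'I_m -> 'I_N} => tot e == a)
  (fun e : {ffun 'I_m -> 'I_N} => tot e == b)).
Qed.

(** The finite comparison of the two groupings: levels below [M] cancel exactly, and the rest is
    bounded in norm by the majorant. *)
Lemma sum_prod_trunc_laurent_le n M N (ks : seq {ffun 'I_m -> int}) :
  (0 < m)%N -> (M + `|n| < N)%N -> uniq ks ->
  (forall k, k \in ks -> \sum_i k i = n) ->
  (forall k : {ffun 'I_m -> int}, \sum_i k i = n ->
    (forall i, (`|k i| <= M + `|n|)%N) -> k \in ks) ->
  `|\sum_(k <- ks) \prod_i trunc_laurent N (k i) (x i) (y i)
    - \sum_(J < M) laurent_term n (\sum_i x i) (\sum_i y i) J|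
  <= \sum_(M <= J < (N * m).+1)
      laurent_term n (\sum_i `|x i|) (\sum_i `|y i|) J.
Proof.
move=> m0 MN ks_uniq ks_n n_ks; have nE := int_pos_negP n.
under eq_bigr do rewrite prod_trunc_laurent big_mkcond.
rewrite exchange_big /=.
have -> : \sum_(e : idx N)
    \sum_(k <- ks) (if diff e == k then mon x y e else 0)
    = \sum_(e : idx N | (\sum_i diff e i == n) && (diff e \in ks)) mon x y e.
  rewrite [RHS]big_mkcond; apply: eq_bigr => e _; rewrite -big_mkcond.
  under eq_bigl do rewrite eq_sym.
  have [dk|dk] := boolP (diff e \in ks).
    by rewrite ks_n // eqxx -big_filter filter_pred1_uniq ?big_seq1.
  rewrite andbF big_seq_cond big_pred0 // => k.
  by apply/negP => /andP[kks /eqP kd]; rewrite -kd kks in dk.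
(* Below level [M] both totals are less than M + |n|, hence so is every difference in absolute
   value. *)
have small (e : idx N) : \sum_i diff e i == n ->
    (tot e.1 - int_pos n < M)%N -> diff e \in ks.
  move=> /eqP en eM; apply: n_ks => // i.
  have e1 : (e.1 i <= tot e.1)%N by rewrite /tot (bigD1 i) //= leq_addr.
  have e2 : (e.2 i <= tot e.2)%N by rewrite /tot (bigD1 i) //= leq_addr.
  rewrite sum_diff in en; rewrite ffunE; lia.
have NmM : (M <= (N * m).+1)%N.
  by rewrite (leq_trans _ (leqW (leq_pmulr _ m0))) //; lia.
(* Since M + |n| < N, the truncation at [N] is invisible to the coefficients of levels below [M]. *)
have low : \sum_(J < M) laurent_term n (\sum_i x i) (\sum_i y i) J =
    \sum_(e : idx N | (\sum_i diff e i == n)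
                      && (tot e.1 - int_pos n < M)%N) mon x y e.
  rewrite (@sum_level _ (N * m).+1 _ (fun J => J < M)%N) //.
  rewrite (big_ord_widen _ _ NmM); apply: eq_bigr => J JM.
  by rewrite sum_mon !coef_prod_trunc_exp //; lia.
rewrite (bigID (fun e => (tot e.1 - int_pos n < M)%N)) /=.
rewrite (eq_bigl (fun e => (\sum_i diff e i == n)
                           && (tot e.1 - int_pos n < M)%N)); last first.
  move=> e; case: (boolP (\sum_i diff e i == n)) => //= en.
  by case: ltnP => eM; rewrite ?andbF // small.
rewrite low [X in `|X|]addrC addKr.
apply: le_trans (ler_norm_sum _ _ _) _.
have norm_mon (e : idx N) :
    `|mon x y e| = mon (fun i => `|x i|) (fun i => `|y i|) e.
  rewrite /mon normrM !normr_prod.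
  by congr (_ * _); apply: eq_bigr => i _; rewrite norm_powfact.
rewrite (eq_bigr _ (fun e _ => norm_mon e)).
(* Dropping the condition [diff e \in ks] only adds nonnegative terms. *)
apply: (@le_trans _ _ (\sum_(e : idx N | (\sum_i diff e i == n)
    && (M <= tot e.1 - int_pos n)%N) mon (fun i => `|x i|) (fun i => `|y i|) e)).
  rewrite [leLHS]big_mkcond [leRHS]big_mkcond ler_sum // => e _.
  have : 0 <= mon (fun i => `|x i|) (fun i => `|y i|) e.
    by rewrite -norm_mon.
  by rewrite -leqNgt; case: (_ == _); case: (_ \in _); case: (_ <= _)%N.
rewrite (@sum_level _ (N * m).+1 _ (fun J => M <= J)%N) //.
rewrite big_geq_mkord; apply: ler_sum => J _; rewrite sum_mon.
by rewrite ler_pM ?coef_prod_trunc_exp_ge0 ?coef_prod_trunc_exp_le.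
Qed.

End Truncation.

(** * Convergence of the real series and Bessel functions of all integer orders *)

Section RealSeries.
Variable R : realType.
Implicit Types (r s t : R) (k n : int).

Lemma powfact_le_expR s a : 0 <= s -> powfact s a <= expR s.
Proof.
move=> s0; case: a => [|a].
  by rewrite /powfact expr0 fact0 divr1 (le_trans _ (expR_ge1Dx s)) // lerDl.
by rewrite (le_trans _ (expR_ge1Dxn a s0)) // lerDr.
Qed.

Lemma is_cvg_series_powfact_shift s q :
  cvgn (series (fun j => powfact s (j + q))).
Proof.
have := is_cvg_series_exp_coeff s.
rewrite -(is_cvg_series_restrict q) => /cvg_ex[l ul].
apply/cvg_ex; exists l; rewrite -(cvg_shiftn q) in ul.
apply: cvg_trans ul; apply: near_eq_cvg; near=> N.
by rewrite /series /= -{1}[q]add0n big_addn addnK.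
Unshelve. all: by end_near. Qed.

(** Bounding one factor by [expR s] leaves a shifted exponential series. *)
Lemma is_cvg_series_laurent_term_diag n s :
  0 <= s -> cvgn (series (laurent_term n s s)).
Proof.
move=> s0.
apply: (@series_le_cvg _ _ (expR s \*o (fun j => powfact s (j + int_neg n)))).
- by move=> j; exact: laurent_term_ge0.
- by move=> j; rewrite /= mulr_ge0 ?expR_ge0 ?powfact_ge0.
- by move=> j; rewrite /= ler_wpM2r ?powfact_ge0 ?powfact_le_expR.
exact/is_cvg_seriesZ/is_cvg_series_powfact_shift.
Qed.

Lemma is_cvg_series_bessel k r :
  cvgn (series (laurent_term k (r / 2) (- (r / 2)))).
Proof.
apply: normed_cvg.
rewrite [X in cvgn (series X)](_ : _ = laurent_term k `|r / 2| `|r / 2|).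
  exact: is_cvg_series_laurent_term_diag.
by apply/funext => j; rewrite /= norm_laurent_term normrN.
Qed.

Lemma bessel_termE p r j :
  bessel_term p r j = laurent_term p (r / 2) (- (r / 2)) j.
Proof.
rewrite /bessel_term /laurent_term /powfact /= addn0 (exprNn (r / 2)) natrM invfM.
have -> : (2 * j + p = (j + p) + j)%N by lia.
rewrite exprD; ring.
Qed.

(** One formula for both signs of [k]: for negative [k] the extra exponent falls on - r/2 instead of
    r/2, which yields the sign (-1)^(p+1). *)
Lemma besselJE k r :
  besselJ k r = limn (series (laurent_term k (r / 2) (- (r / 2)))).
Proof.
case: k => p /=.
  by congr (limn (series _)); apply/funext => j; exact: bessel_termE.
have E : bessel_term p.+1 r = laurent_term p.+1 (r / 2) (- (r / 2)).
  by apply/funext => j; exact: bessel_termE.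
apply/esym/cvg_lim => //; rewrite E.
rewrite [X in X @ _](_ : _ = (fun N => (-1) ^+ p.+1
    * series (laurent_term p.+1 (r / 2) (- (r / 2))) N)).
  by apply: cvgM; [exact: cvg_cst|exact: is_cvg_series_bessel].
apply/funext => N; rewrite /series /= mulr_sumr; apply: eq_bigr => j _.
rewrite /laurent_term /powfact /= !addn0 !(exprNn (r / 2)) !exprD; ring.
Qed.

Lemma cvg_series_besselJ k r :
  series (laurent_term k (r / 2) (- (r / 2))) @ \oo --> besselJ k r.
Proof. by rewrite besselJE; exact: is_cvg_series_bessel. Qed.

End RealSeries.

(** * Phases and the embedding of the reals into the complex numbers *)

Section ComplexTerms.
Variable R : realType.
Implicit Types (r s t : R) (k n : int).

Lemma expi0 : expi (0 : R) = 1.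
Proof. by rewrite /expi cos0 sin0. Qed.

Lemma expiD s t : expi (s + t) = expi s * expi t.
Proof.
by rewrite /expi cosD sinD; apply/eqP; rewrite eq_complex /= addrC !eqxx;
 rewrite [X in X == _]addrC eqxx.
Qed.

Lemma expiN t : expi (- t) = (expi t)^*.
Proof. by rewrite /expi cosN sinN. Qed.

Lemma expiX t a : expi t ^+ a = expi (a%:R * t).
Proof.
elim: a => [|a IH]; first by rewrite mul0r expi0.
by rewrite exprS IH -expiD -natr1 mulrDl mul1r addrC.
Qed.

(** The exponents differ by [k] at every level, so the phase is independent of [j]. *)
Lemma laurent_term_expi k (x y : R[i]) t j :
  laurent_term k (x * expi t) (y * expi (- t)) j
  = expi (k%:~R * t) * laurent_term k x y j.
Proof.
rewrite /laurent_term /powfact !exprMn !expiX.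
have -> : k%:~R * t = (j + int_pos k)%:R * t + (j + int_neg k)%:R * - t.
  have [kE _] := int_pos_negP k; rewrite {1}kE rmorphB /= !natrD -!pmulrn; ring.
by rewrite expiD; ring.
Qed.

Lemma powfact_real_complex r a : powfact r%:C a = (powfact r a)%:C.
Proof. by rewrite /powfact rmorphM /= fmorphV rmorphXn /= rmorph_nat. Qed.

Lemma laurent_term_real_complex k r s j :
  laurent_term k r%:C s%:C j = (laurent_term k r s j)%:C.
Proof. by rewrite /laurent_term !powfact_real_complex [RHS]rmorphM. Qed.

Lemma cvg_real_complex (u : nat -> R) (l : R) : u @ \oo --> l ->
  (fun N => (u N)%:C : R[i]^o) @ \oo --> (l%:C : R[i]^o).
Proof.
move=> /cvgrPdist_lt ul; apply/cvgrPdist_lt => e e0.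
(* A positive complex number is real, so the estimate reduces to one over the reals. *)
have eE : (complex.Re e)%:C = e by exact/RRe_real/gtr0_real.
have e0' : 0 < complex.Re e by rewrite -ltcR eE.
near=> N; rewrite -eE -rmorphB /= normc_def /= expr0n addr0 sqrtr_sqr ltcR.
by near: N; exact: ul.
Unshelve. all: by end_near. Qed.

End ComplexTerms.

(** The half comes from the generating function exp((r/2)(t - 1/t)) of the J_k(r). *)
Definition half_complex (R : realType) (v : 'rV[R]_2) : R[i] :=
  (v 0 0 / 2) +i* (v 0 1 / 2).

Lemma half_complex_sum (R : realType) m (x : 'I_m -> 'rV[R]_2) :
  half_complex (\sum_i x i) = \sum_i half_complex (x i).
Proof.
rewrite (big_morph (@half_complex R) (id1 := 0) (op1 := +%R)) //.
  by move=> u v; rewrite /half_complex !mxE !mulrDl.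
by rewrite /half_complex !mxE !mul0r.
Qed.

(** * Polar form, and Bessel functions as limits of Laurent coefficients *)

Section Polar.
Variables (R : realType) (arg : 'rV[R]_2 -> R).
Hypothesis argP : is_arg arg.
Implicit Types (v : 'rV[R]_2) (k n : int).

(** At [v = 0] both sides vanish, whatever the value of [arg 0]. *)
Lemma half_complex_polar v :
  half_complex v = (norm2 v / 2)%:C * expi (arg v).
Proof.
have [->|/argP[v0 v1]] := eqVneq v 0.
  by rewrite /half_complex /norm2 !mxE expr0n addr0 sqrtr0 !mul0r.
by rewrite /half_complex v0 v1; simpc; congr (_ +i* _); ring.
Qed.

Lemma half_complex_conj_polar v :
  - (half_complex v)^* = (- (norm2 v / 2))%:C * expi (- arg v).
Proof.
rewrite half_complex_polar expiN; case: (expi _) => a b.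
by simpc; congr (_ +i* _); ring.
Qed.

Lemma cvg_sum_laurent_half_complex k v :
  (fun N => \sum_(j < N)
     laurent_term k (half_complex v) (- (half_complex v)^*) j : R[i]^o)
  @ \oo --> (expi (k%:~R * arg v) * (besselJ k (norm2 v))%:C : R[i]^o).
Proof.
rewrite [X in X @ _](_ : _ = (fun N => expi (k%:~R * arg v) *
  (series (laurent_term k (norm2 v / 2) (- (norm2 v / 2))) N)%:C)); last first.
  apply/funext => N; rewrite /series /= rmorph_sum mulr_sumr big_mkord.
  apply: eq_bigr => j _; rewrite half_complex_conj_polar half_complex_polar.
  by rewrite laurent_term_expi laurent_term_real_complex.
apply: (@cvgM R[i]); first exact: cvg_cst.
exact/cvg_real_complex/cvg_series_besselJ.
Qed.

Lemma cvg_trunc_laurent k v :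
  (fun N => trunc_laurent N k (half_complex v) (- (half_complex v)^*) : R[i]^o)
  @ \oo --> (expi (k%:~R * arg v) * (besselJ k (norm2 v))%:C : R[i]^o).
Proof.
rewrite (funext (fun N => trunc_laurentE N k _ _)).
have := @cvg_sum_laurent_half_complex k v.
(* The index N - |k| tends to infinity with N. *)
by rewrite -(cvg_centern `|k|).
Qed.

Lemma cvg_sum_prod_trunc_laurent m (x : 'I_m -> 'rV[R]_2)
    (ks : seq {ffun 'I_m -> int}) :
  (fun N => \sum_(k <- ks) \prod_i trunc_laurent N (k i)
     (half_complex (x i)) (- (half_complex (x i))^*) : R[i]^o)
  @ \oo --> (\sum_(k <- ks) \prod_i
     (expi ((k i)%:~R * arg (x i)) * (besselJ (k i) (norm2 (x i)))%:C) : R[i]^o).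
Proof.
apply: cvg_big => [|k _]; first exact: add_continuous.
apply: (@cvg_big R[i]^o) => [|i _]; first exact: mul_continuous.
exact: cvg_trunc_laurent.
Qed.

End Polar.

(** * Uniform tails, finite index sets, and the limit *)

(** The Cauchy criterion gives a bound uniform in [Q], so the truncation [N] can be chosen after
    [M]. *)
Lemma laurent_tail_small (R : realType) n (s : R) (e : R[i]) :
  0 <= s -> 0 < e -> exists M0, forall M Q, (M0 <= M <= Q)%N ->
  \sum_(M <= J < Q) laurent_term n s%:C s%:C J < e.
Proof.
move=> s0 e0; have eE : (complex.Re e)%:C = e by exact/RRe_real/gtr0_real.
have e0' : 0 < complex.Re e by rewrite -ltcR eE.
have /cauchy_cvgP/cauchy_seriesP := is_cvg_series_laurent_term_diag (n := n) s0.
move=> /(_ _ e0')[[A B]] /= [[a _ Aa] [b _ Bb]] AB.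
exists (maxn a b) => M Q /andP[abM MQ].
have := AB (M, Q); rewrite /= => /(_ _)/wrap[].
  by split; [apply: Aa|apply: Bb] => /=; lia.
rewrite ger0_norm; last by apply: sumr_ge0 => j _; exact: laurent_term_ge0.
rewrite -ltcR eE; apply: le_lt_trans; rewrite rmorph_sum le_eqVlt.
by apply/orP; left; apply/eqP/eq_bigr => j _; rewrite laurent_term_real_complex.
Qed.

(** Adding [L] to each entry places the bounded vectors among the finitely many functions into
    0..2L; [insub] keeps those of sum [n]. *)
Lemma exists_fset_bounded m (n : int) (L : nat) :
  exists A : {fset {k : {ffun 'I_m -> int} | \sum_(i < m) k i == n}},
    forall k : {k : {ffun 'I_m -> int} | \sum_(i < m) k i == n},
      (forall i, (`|val k i| <= L)%N) -> k \in A.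
Proof.
pose shift (o : {ffun 'I_m -> 'I_(2 * L).+1}) : {ffun 'I_m -> int} :=
  [ffun i => (o i)%:Z - L%:Z].
exists [fset k in pmap insub (map shift (enum {ffun 'I_m -> 'I_(2 * L).+1}))]%fset.
move=> k kL; rewrite inE /= mem_pmap_sub /=.
apply/mapP; exists [ffun i => inord `|val k i + L%:Z|]; first by rewrite mem_enum.
apply/ffunP => i; rewrite !ffunE; move: (kL i); move: (val k i) => c cL.
by rewrite inordK; lia.
Qed.

Theorem proposition2p2 (R : realType) (arg : 'rV[R]_2 -> R) (argP : is_arg arg)
    (n : int) (m : nat) (m_ge1 : (1 <= m)%N) (x : 'I_m -> 'rV[R]_2) :
  partial_sum (fun k : {k : {ffun 'I_m -> int} | \sum_(i < m) k i == n} =>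
      \prod_(i < m) (expi ((val k i)%:~R * arg (x i))
                     * (besselJ (val k i) (norm2 (x i)))%:C) : R[i]^o)
    @ totally -->
  ((besselJ n (norm2 (\sum_(i < m) x i)))%:C
   * expi (n%:~R * arg (\sum_(i < m) x i)) : R[i]^o).
Proof.
pose z i := half_complex (x i).
pose w i := - (half_complex (x i))^*.
(* Conjugation preserves the modulus, so one [s] serves for both the [z i] and the [w i]. *)
pose s : R := \sum_i ComplexField.Normc.normc (z i).
have s0 : 0 <= s by apply: sumr_ge0 => i _; exact: sqrtr_ge0.
have zs : \sum_i `|z i| = s%:C by rewrite rmorph_sum.
have ws : \sum_i `|w i| = s%:C.
  by rewrite -zs; apply: eq_bigr => i _; rewrite normrN normcJ.
apply/cvgrPdist_lt => e e0.
(* The three thirds pay for cutting the right-hand side at level [M], comparing the groupings, and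
   truncating the finite left-hand sum at [N]. *)
have e3 : 0 < e / 3%:R by rewrite divr_gt0.
have [M0 tail] := laurent_tail_small n s0 e3.
have := cvg_sum_laurent_half_complex argP (k := n) (v := \sum_i x i).
move=> /cvgrPdist_lt/(_ _ e3)[M1 _ lim1].
pose M := maxn M0 M1.
have [A0 A0P] := exists_fset_bounded m n (M + `|n|).
(* Every finite [A] containing [A0] captures all indices that meet levels below [M]. *)
exists A0 => // A /= A0A.
pose ks := [seq val k | k <- enum_fset A].
have -> : partial_sum (fun k : {k : {ffun 'I_m -> int} | \sum_(i < m) k i == n} =>
      \prod_(i < m) (expi ((val k i)%:~R * arg (x i))
                     * (besselJ (val k i) (norm2 (x i)))%:C) : R[i]^o) A
  = \sum_(k <- ks) \prod_i
     (expi ((k i)%:~R * arg (x i)) * (besselJ (k i) (norm2 (x i)))%:C).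
  by rewrite /partial_sum big_map [RHS]big_seq_fsetE.
have := cvg_sum_prod_trunc_laurent argP (x := x) (ks := ks).
move=> /cvgrPdist_lt/(_ _ e3)[N1 _ lim2].
(* [N] comes last: the rate [N1] depends on [A], whereas [M] and the tail bound do not. *)
pose N := maxn N1 (M + `|n|).+1.
have {}lim2 := lim2 N (leq_maxl _ _).
have {}lim1 := lim1 M (leq_maxr _ _).
have mid : `|\sum_(k <- ks) \prod_i trunc_laurent N (k i) (z i) (w i)
    - \sum_(J < M) laurent_term n (\sum_i z i) (\sum_i w i) J| < e / 3%:R.
  apply: le_lt_trans (sum_prod_trunc_laurent_le _ _ _ _ _ _ _) _ => //.
  - by rewrite leq_maxr.
  - by rewrite map_inj_uniq ?fset_uniq //; exact: val_inj.
  - by move=> k /mapP[k' _ ->]; exact/eqP/(valP k').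
  - move=> k /eqP kn kL; apply/mapP; exists (Sub k kn); last by rewrite SubK.
    by apply: (fsubsetP A0A); apply: A0P => i; rewrite SubK.
  rewrite zs ws; apply: tail; rewrite leq_maxl /=.
  by rewrite leqW // (leq_trans _ (leq_pmulr _ m_ge1)) // /N; lia.
rewrite half_complex_sum in lim1.
have wE : - (\sum_i half_complex (x i))^* = \sum_i w i.
  by rewrite rmorph_sum -sumrN.
rewrite wE in lim1; rewrite mulrC.
set a := expi _ * _ in lim1 *; set b := \sum_(k <- ks) _ in lim2 *.
set c := \sum_(k <- ks) _ in lim2 mid; set d := \sum_(J < M) _ in lim1 mid.
have -> : a - b = (a - d) - (c - d) - (b - c) by ring.
have -> : e = e / 3%:R + e / 3%:R + e / 3%:R by field.
rewrite (le_lt_trans (ler_normB _ _)) // ltrD //.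
by rewrite (le_lt_trans (ler_normB _ _)) // ltrD.
Qed.
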